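(* Let $(G,m,w,B)$ be a connected weighted finite graph with boundary, $|B|\ge2$. Suppose that the Ollivier curvature of $(G,m,w)$ is not less than a positive constant $\kappa$, i.e. $\kappa(x,y)\ge\kappa$ for any two distinct vertices $x,y$. Then the second Steklov eigenvalue satisfies $$\sigma_2\ge\kappa.$$
   Context: A weighted graph $(G,m,w)$ consists of a finite, simple, connected graph $G$ with vertex set $V$ and edge set $E$, a positive function $m$ on $V$ (vertex measure, written $m_x$), and a positive function $w$ on $E$ (edge weight), regarded as a symmetric function $w_{xy}$ on $V\times V$ by setting $w_{xy}=0$ when $\{x,y\}\notin E$. Graph with boundary: $(G,m,w,B)$ is a weighted graph together with a nonempty set $B\subset V$ (the boundary) such that no two vertices of $B$ are adjacent and every vertex of $B$ is adjacent to some vertex of $\Omega:=V\setminus B$ (the interior). Laplacian: for $u\in\mathbb{R}^V$, $\Delta u(x)=\frac1{m_x}\sum_{y\in V}(u(y)-u(x))w_{xy}$. Steklov eigenvalues: for $f\in\mathbb{R}^B$ let $u_f\in\mathbb{R}^V$ be the unique function with $u_f=f$ on $B$ and $\Delta u_f=0$ on $\Omega$. The Dirichlet-to-Neumann map $\Lambda:\mathbb{R}^B\to\mathbb{R}^B$ is $\Lambda f(x)=\frac{\partial u_f}{\partial n}(x)$, where $\frac{\partial u}{\partial n}(x)=\frac1{m_x}\sum_{y\in V}(u(x)-u(y))w_{xy}$ for $x\in B$. It is nonnegative and self-adjoint for $\langle f,g\rangle_B=\sum_{x\in B}f(x)g(x)m_x$; its eigenvalues, counted with multiplicity, are $0=\sigma_1<\sigma_2\le\cdots\le\sigma_{|B|}$.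 Ollivier curvature (in the sense of Münch and Wojciechowski): let $d$ be the combinatorial graph distance on $V$ (least number of edges in a path), $\nabla_{xy}f=\frac{f(x)-f(y)}{d(x,y)}$ for $x\ne y$, and $\mathrm{Lip}(1)=\{f\in\mathbb{R}^V: |f(x)-f(y)|\le d(x,y)\ \text{for all } x,y\in V\}$. For distinct vertices $x,y$, the curvature is given by $$\kappa(x,y)=\inf_{f\in\mathrm{Lip}(1),\ \nabla_{yx}f=1}\nabla_{xy}\Delta f.$$ *)

(* Defs.v *)
From HB Require Import structures.
From mathcomp Require Import all_boot all_order all_algebra.
From mathcomp Require Import all_classical all_reals.

Set Implicit Arguments.
Unset Strict Implicit.
Unset Printing Implicit Defensive.

Import Order.TTheory GRing.Theory Num.Theory.

Local Open Scope classical_set_scope.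
Local Open Scope ring_scope.

Record weighted_graph (R : realType) (V : finType) := WeightedGraph {
  adj : rel V;
  vmeas : V -> R;
  weight : V -> V -> R;
  adj_sym : symmetric adj;
  adj_irr : irreflexive adj;
  adj_connected : forall x y, connect adj x y;
  vmeas_gt0 : forall x, 0 < vmeas x;
  weight_sym : forall x y, weight x y = weight y x;
  weight_gt0 : forall x y, adj x y -> 0 < weight x y;
  weight_eq0 : forall x y, ~~ adj x y -> weight x y = 0
}.

Section WeightedGraph.
Variables (R : realType) (V : finType) (G : weighted_graph R V).
Implicit Types (x y : V) (u f : V -> R) (B : {set V}).

Definition walk_of_length x y (n : nat) : bool :=
  [exists p : n.-tuple V, path (adj G) x p && (last x p == y)].

Lemma walk_exists x y : exists n, walk_of_length x y n.
Proof.
have /connectP[p xp ->] := adj_connected G x y.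
by exists (size p); apply/existsP; exists (in_tuple p); rewrite xp eqxx.
Qed.

Definition gdist x y : nat := ex_minn (walk_exists x y).

Definition laplacian u x : R :=
  (vmeas G x)^-1 * \sum_(y : V) (u y - u x) * weight G x y.

Definition grad f x y : R := (f x - f y) / (gdist x y)%:R.

Definition lip1 : set (V -> R) :=
  [set f | forall x y, `|f x - f y| <= (gdist x y)%:R].

(* For x != y the set is nonempty (take f = gdist x) and bounded below, so
   [inf] is a genuine infimum, not its default value 0. *)
Definition ollivier_curvature x y : R :=
  inf [set grad (laplacian f) x y | f in [set f | lip1 f /\ grad f y x = 1]].

Record is_boundary B : Prop := IsBoundary {
  boundary_nonempty : exists x, x \in B;
  boundary_indep : forall x y, x \in B -> y \in B -> ~~ adj G x y;
  boundary_adj_int : forall x, x \in B -> exists2 y, y \notin B & adj G x y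
}.

Definition normal_derivative u x : R :=
  (vmeas G x)^-1 * \sum_(y : V) (u x - u y) * weight G x y.

Section Steklov.
Variable B : {set V}.

Definition bvertex := {x : V | x \in B}.

Definition is_harmonic_extension (f : bvertex -> R) : set (V -> R) :=
  [set u | (forall x : bvertex, u (val x) = f x) /\
           (forall x, x \notin B -> laplacian u x = 0)].

(* For nonempty B the harmonic extension exists and is unique, as G is
   connected; the default value 0 is then irrelevant. *)
Definition harmonic_extension (f : bvertex -> R) : V -> R :=
  xget (fun=> 0) (is_harmonic_extension f).

Definition dtn (f : bvertex -> R) (x : bvertex) : R :=
  normal_derivative (harmonic_extension f) (val x).

(* Matrix of dtn in the basis of indicator functions of boundary vertices
   (column j is the image of the j-th basis function). *)
Definition dtn_mx : 'M[R]_#|{: bvertex}| :=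
  \matrix_(i, j) dtn (fun z => (z == enum_val j)%:R) (enum_val i).

(* The nondecreasing list of all the eigenvalues with multiplicity; it is
   unique, and exists since dtn is self-adjoint. *)
Definition steklov_spectrum : seq R :=
  xget [::] [set s : seq R | sorted <=%R s /\
                             char_poly dtn_mx = \prod_(a <- s) ('X - a%:P)].

(* Indexed from 1. *)
Definition steklov_eigenvalue (k : nat) : R := nth 0 steklov_spectrum k.-1.

End Steklov.

End WeightedGraph.

(* Main.v *)
(** The second Steklov eigenvalue dominates the first nonzero eigenvalue of the
    Laplacian: the Dirichlet-to-Neumann form of a boundary function is the
    Dirichlet energy of its harmonic extension, and subtracting from this
    extension its mean over V leaves, if the boundary function has mean 0 on B,
    an L^2(V) norm at least that of the boundary function. The nonzero
    eigenvalues of the Laplacian are at least kappa, as one sees by testing the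
    curvature with an eigenfunction at a pair of vertices where its Lipschitz
    constant is attained. Converting the bound on quadratic forms into one on
    the characteristic polynomial uses the spectral theorem for real symmetric
    matrices, which also shows that the Steklov spectrum exists. *)
Require Import Defs.
From mathcomp Require Import all_boot all_order all_algebra.
From mathcomp Require Import all_classical all_reals.
From mathcomp Require Import complex.
From mathcomp Require Import ring lra.

Import Order.TTheory GRing.Theory Num.Theory.
Local Open Scope ring_scope.

(** * Spectral theorem for real symmetric matrices *)

Lemma dotmx_ge0 (R : realDomainType) n (v : 'rV[R]_n) : 0 <= (v *m v^T) 0 0.
Proof. by rewrite mxE sumr_ge0 // => i _; rewrite mxE -expr2 sqr_ge0. Qed.

Lemma dotmx_eq0 (R : realDomainType) n (v : 'rV[R]_n) :
  ((v *m v^T) 0 0 == 0) = (v == 0).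
Proof.
apply/eqP/eqP => [|->]; last by rewrite mul0mx mxE.
rewrite mxE => /eqP; rewrite psumr_eq0 => [/allP v0|i _].
  apply/rowP => i; have := v0 i (mem_index_enum i).
  by rewrite !mxE mulf_eq0 orbb => /eqP.
by rewrite mxE -expr2 sqr_ge0.
Qed.

Lemma trmx11 (R : pzSemiRingType) (M : 'M[R]_1) : M^T = M.
Proof. by apply/matrixP => i j; rewrite mxE !ord1. Qed.

(** Over the complex numbers an eigenvector exists; symmetry makes its eigenvalue real, so its real
    and imaginary parts, not both zero, satisfy the same equation. *)
Lemma symmetric_eigenvector (R : rcfType) n (A : 'M[R]_n) :
  (0 < n)%N -> A^T = A ->
  exists a, exists2 v : 'rV_n, v *m v^T = 1%:M & v *m A = a *: v.
Proof.
move=> n_gt0 symA; pose C : numClosedFieldType := complex R.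
pose toC (r : R) : C := Complex r 0.
have [z /eigenvalueP[w wA w_neq0]] :=
  eigenvalue_closed (map_mx toC A : 'M[C]_n) n_gt0.
pose x := \row_j complex.Re (w 0 j); pose y := \row_j complex.Im (w 0 j).
pose a := complex.Re z; pose b := complex.Im z.
have key k : \sum_j w 0 j * toC (A j k) = z * w 0 k.
  move/rowP/(_ k): wA; rewrite !mxE => <-.
  by apply: eq_bigr => j _; rewrite mxE.
have Re_real (c : C) r : complex.Re (c * toC r) = complex.Re c * r.
  by case: c => c1 c2 /=; rewrite mulr0 subr0.
have Im_real (c : C) r : complex.Im (c * toC r) = complex.Im c * r.
  by case: c => c1 c2 /=; rewrite mulr0 add0r.
have Re_sum (F : 'I_n -> C) :
    complex.Re (\sum_j F j) = \sum_j complex.Re (F j).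
  by elim/big_rec2: _ => //= j ? [? ?] _ /= <-; case: (F j).
have Im_sum (F : 'I_n -> C) :
    complex.Im (\sum_j F j) = \sum_j complex.Im (F j).
  by elim/big_rec2: _ => //= j ? [? ?] _ /= <-; case: (F j).
have xA : x *m A = a *: x - b *: y.
  apply/rowP => k; have := congr1 (@complex.Re R) (key k).
  rewrite Re_sum !mxE => E; transitivity (complex.Re (z * w 0 k)).
    by rewrite -E; apply: eq_bigr => j _; rewrite Re_real !mxE.
  by rewrite /a /b; case: (z) (w 0 k) => ? ? [].
have yA : y *m A = b *: x + a *: y.
  apply/rowP => k; have := congr1 (@complex.Im R) (key k).
  rewrite Im_sum !mxE => E; transitivity (complex.Im (z * w 0 k)).
    by rewrite -E; apply: eq_bigr => j _; rewrite Im_real !mxE.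
  by rewrite /a /b; case: (z) (w 0 k) => ? ? [] ? ? /=; ring.
have xy_neq0 : (x != 0) || (y != 0).
  rewrite -negb_and; apply: contra w_neq0 => /andP[/eqP/rowP x0 /eqP/rowP y0].
  apply/eqP/rowP => k; move: (x0 k) (y0 k); rewrite !mxE.
  by case: (w 0 k) => ? ? /= -> ->.
(* Symmetry equates [x *m A *m y^T] with [y *m A *m x^T], which leaves [b] times the sum of the
   squared norms of [x] and [y] equal to 0. *)
have b0 : b = 0.
  have : (x *m A *m y^T) = (y *m A *m x^T).
    by rewrite -[LHS]trmx11 !trmx_mul trmxK symA mulmxA.
  rewrite xA yA !mulmxDl -!scaleNr -!scalemxAl => /matrixP/(_ 0 0).
  have -> : x *m y^T = y *m x^T.
    by rewrite -[LHS]trmx11 trmx_mul trmxK.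
  move: (dotmx_ge0 _ _ x) (dotmx_ge0 _ _ y) xy_neq0.
  rewrite -(dotmx_eq0 _ _ x) -(dotmx_eq0 _ _ y) !mxE.
  set X := \sum_j _; set Y := \sum_j _; set W := \sum_j _ => X0 Y0 XY.
  move=> e; apply/eqP; have: b * (X + Y) == 0 by apply/eqP; lra.
  rewrite mulf_eq0 => /orP[//|]; rewrite paddr_eq0 // => /andP[xx yy].
  by rewrite xx yy in XY.
have normalize (u : 'rV[R]_n) : u != 0 -> u *m A = a *: u ->
    exists2 v : 'rV_n, v *m v^T = 1%:M & v *m A = a *: v.
  move=> u0 uA; pose s := (u *m u^T) 0 0.
  have s0 : 0 < s by rewrite lt_neqAle dotmx_ge0 eq_sym dotmx_eq0 u0.
  exists ((Num.sqrt s)^-1 *: u); last first.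
    by rewrite -scalemxAl uA !scalerA mulrC.
  rewrite -scalemxAl linearZ /= -scalemxAr scalerA [u *m _]mx11_scalar -/s.
  rewrite scale_scalar_mx -invfM -expr2 sqr_sqrtr ?ltW //.
  by rewrite mulVf // gt_eqF.
exists a; case/orP: xy_neq0 => /normalize; apply.
- by rewrite xA b0 scale0r subr0.
- by rewrite yA b0 scale0r add0r.
Qed.

(** The reflection in the hyperplane orthogonal to [v - u] serves, or the identity if [u] and [v]
    coincide. *)
Lemma householder (R : realFieldType) n (u v : 'rV[R]_n) :
  u *m u^T = 1%:M -> v *m v^T = 1%:M ->
  exists2 H : 'M[R]_n, H^T = H /\ H *m H = 1%:M & u *m H = v.
Proof.
move=> uu vv; have [w wE] : exists w, w = v - u by exists (v - u).
have [w0|w_neq0] := eqVneq w 0.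
  exists 1%:M; first by rewrite trmx1 mulmx1.
  by rewrite mulmx1; apply/esym/eqP; rewrite -subr_eq0 -wE w0.
pose s := (w *m w^T) 0 0.
have s_neq0 : s != 0 by rewrite dotmx_eq0.
have ww : w *m w^T = s%:M by rewrite -mx11_scalar.
have uv : v *m u^T = u *m v^T.
  by rewrite -[LHS]trmx11 trmx_mul trmxK.
have wwE : w *m w^T = 2%:M - (u *m v^T) *+ 2.
  rewrite wE linearB /= mulmxBl !mulmxBr uu vv uv.
  by apply/matrixP => i j; rewrite !mxE !ord1 /=; lra.
have uw : u *m w^T = (- (s / 2))%:M.
  rewrite /s wwE wE linearB /= mulmxBr uu.
  by apply/matrixP => i j; rewrite !ord1 !mxE /=; lra.
(* Since [u *m w^T] is [- (s / 2)], this reflection adds exactly [w] to [u]. *)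
exists (1%:M - (2 / s) *: (w^T *m w)); last first.
  rewrite mulmxBr mulmx1 -scalemxAr mulmxA uw mul_scalar_mx scalerA.
  have -> : 2 / s * - (s / 2) = -1 by field; rewrite s_neq0.
  by rewrite scaleN1r opprK wE addrC subrK.
split; first by rewrite linearB /= trmx1 linearZ /= trmx_mul trmxK.
rewrite mulmxBl mul1mx mulmxBr mulmx1 -!scalemxAl -!scalemxAr scalerA.
have -> : w^T *m w *m (w^T *m w) = s *: (w^T *m w).
  by rewrite mulmxA -[_ *m w *m w^T]mulmxA ww mul_mx_scalar scalemxAl.
rewrite scalerA; have -> : 2 / s * (2 / s) * s = 2 / s + 2 / s by field.
by rewrite scalerDl opprB addrK subrK.
Qed.

(** Induction on [n]: conjugation by a reflection that carries the first basis vector to a unit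
    eigenvector splits off a block of size 1 and leaves a smaller symmetric one. *)
Theorem symmetric_spectral (R : rcfType) n (A : 'M[R]_n) :
  A^T = A ->
  exists P : 'M[R]_n, exists2 d : 'rV_n,
    P *m P^T = 1%:M & P *m A = diag_mx d *m P.
Proof.
elim: n A => [|n IHn] A symA.
  by exists 0; exists 0; apply/matrixP => -[].
have [a [v vv vA]] := symmetric_eigenvector _ _ _ (ltn0Sn n) symA.
pose e : 'rV[R]_(1 + n) := row_mx 1%:M 0.
have ee : e *m e^T = 1%:M.
  by rewrite tr_row_mx trmx1 mul_row_col mul1mx mul0mx addr0.
have [H [symH HH] eH] := householder _ _ _ _ ee vv.
have vH : v *m H = e by rewrite -eH -mulmxA HH mulmx1.
pose B : 'M[R]_(1 + n) := H *m A *m H.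
have symB : B^T = B by rewrite /B !trmx_mul symH symA mulmxA.
have eB : e *m B = a *: e by rewrite /B !mulmxA eH vA -scalemxAl vH.
(* The equation [eB] fixes the first row, and symmetry then the first column. *)
have BE : B = block_mx a%:M 0 0 (drsubmx B).
  have: usubmx B = row_mx a%:M 0.
    move: eB; rewrite -{1}[B]vsubmxK mul_row_col mul1mx mul0mx addr0 => ->.
    by rewrite scale_row_mx scaler0 scale_scalar_mx mulr1.
  move=> uB; have urB : ursubmx B = 0 by rewrite /ursubmx uB row_mxKr.
  have ulB : ulsubmx B = a%:M by rewrite /ulsubmx uB row_mxKl.
  have dlB : dlsubmx B = 0 by rewrite -symB -trmx_ursub urB trmx0.
  by rewrite -{1}[B]submxK ulB urB dlB.
have symD : (drsubmx B)^T = drsubmx B by rewrite trmx_drsub symB.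
have [P [d PP PD]] := IHn _ symD.
pose Q : 'M_(1 + n) := block_mx 1%:M 0 0 P.
have QQ : Q *m Q^T = 1%:M.
  rewrite /Q tr_block_mx mulmx_block !trmx0 trmx1 PP.
  by rewrite !(mulmx0, mul0mx, mulmx1, addr0, add0r) -scalar_mx_block.
have QB : Q *m B = diag_mx (row_mx a%:M d) *m Q.
  rewrite /Q [in LHS]BE diag_mx_row !mulmx_block PD.
  have -> : diag_mx (a%:M : 'rV_1) = a%:M.
    by apply/matrixP => i j; rewrite !ord1 !mxE.
  by rewrite !(mulmx0, mul0mx, mulmx1, mul1mx, addr0, add0r).
exists (Q *m H); exists (row_mx a%:M d).
  by rewrite trmx_mul symH mulmxA -[Q *m H *m H]mulmxA HH mulmx1.
by rewrite mulmxA -QB /B !mulmxA -[_ *m H *m H]mulmxA HH mulmx1.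
Qed.

(** * Matrices self-adjoint for a weighted inner product *)

(** Conjugating [M] by the square root [S] of [diag_mx mu] gives a symmetric matrix, whose
    orthonormal eigenvectors, rescaled by the inverse [T], are the rows of [P]. [M] is transposed
    because vectors are rows. *)
Lemma weighted_spectral (R : rcfType) n (mu : 'rV[R]_n) (M : 'M[R]_n) :
  (forall i, 0 < mu 0 i) -> (diag_mx mu *m M)^T = diag_mx mu *m M ->
  exists P : 'M[R]_n, exists2 d : 'rV_n,
    P *m diag_mx mu *m P^T = 1%:M & P *m M^T = diag_mx d *m P.
Proof.
move=> mu_gt0 symM.
pose S : 'M[R]_n := diag_mx (\row_i Num.sqrt (mu 0 i)).
pose T : 'M[R]_n := diag_mx (\row_i (Num.sqrt (mu 0 i))^-1).
have TS : T *m S = 1%:M.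
  apply/matrixP => i j; rewrite mul_diag_mx !mxE.
  case: eqP => [->|_]; last by rewrite mulr0n mulr0.
  by rewrite mulr1n mulVf // gt_eqF // sqrtr_gt0.
have ST : S *m T = 1%:M by apply: mulmx1C.
have SS : S *m S = diag_mx mu.
  apply/matrixP => i j; rewrite mul_diag_mx !mxE mulrnAr -expr2.
  by case: eqP => [->|]; rewrite ?mulr0n // sqr_sqrtr // ltW.
have ST' : T^T = T by rewrite tr_diag_mx.
have SS' : S^T = S by rewrite tr_diag_mx.
have symM' : M^T *m (S *m S) = S *m S *m M.
  by rewrite SS -symM trmx_mul tr_diag_mx.
have symA : (S *m M *m T)^T = S *m M *m T.
  rewrite !trmx_mul ST' SS' -[RHS]mul1mx -TS !mulmxA.
  by rewrite -[T *m S *m S]mulmxA -[T *m (S *m S) *m M]mulmxA -symM'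
    !mulmxA -[_ *m S *m T]mulmxA ST mulmx1.
have [Q [d QQ QA]] := symmetric_spectral _ _ _ symA.
exists (Q *m T); exists d.
  rewrite trmx_mul ST' -SS !mulmxA -[Q *m T *m S]mulmxA TS mulmx1.
  by rewrite -[Q *m S *m T]mulmxA ST mulmx1.
rewrite mulmxA -QA -symA !trmx_mul ST' SS' !mulmxA.
by rewrite -[_ *m S *m T]mulmxA ST mulmx1.
Qed.

Section EigenbasisForm.
Variables (R : realDomainType) (n : nat) (mu d : 'rV[R]_n) (M P : 'M[R]_n).
Hypothesis P_orthonormal : P *m diag_mx mu *m P^T = 1%:M.
Hypothesis P_eigen : P *m M^T = diag_mx d *m P.

(** In the coordinates [x] along the rows of [P] both quadratic forms are diagonal. *)
Lemma form_eigenbasis (kappa : R) (x : 'rV_n) (v := x *m P) :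
  (v *m diag_mx mu *m M *m v^T) 0 0 - kappa * (v *m diag_mx mu *m v^T) 0 0 =
  \sum_k (d 0 k - kappa) * x 0 k ^+ 2.
Proof.
have -> : v *m diag_mx mu *m v^T = x *m x^T.
  transitivity (x *m (P *m diag_mx mu *m P^T) *m x^T).
    by rewrite trmx_mul !mulmxA.
  by rewrite P_orthonormal mulmx1.
have -> : v *m diag_mx mu *m M *m v^T = x *m diag_mx d *m x^T.
  transitivity (x *m (P *m diag_mx mu *m (P *m M^T)^T) *m x^T).
    by rewrite !trmx_mul trmxK !mulmxA.
  by rewrite P_eigen trmx_mul tr_diag_mx (mulmxA (P *m _)) P_orthonormal mul1mx.
rewrite !mxE mulr_sumr -sumrB; apply: eq_bigr => k _.
by rewrite mul_mx_diag !mxE; ring.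
Qed.

End EigenbasisForm.

Lemma char_poly_eigenbasis (R : fieldType) n (d : 'rV[R]_n) (M P : 'M[R]_n) :
  P \in unitmx -> P *m M^T = diag_mx d *m P ->
  char_poly M = \prod_i ('X - (d 0 i)%:P).
Proof.
move=> Punit PM.
have -> : char_poly M = char_poly M^T.
  rewrite /char_poly -det_tr; congr (\det _).
  by apply/matrixP => i j; rewrite !mxE eq_sym.
have -> : char_poly M^T = char_poly (diag_mx d).
  (* Instead of inverting [P] over polynomials, its nonzero determinant is cancelled from both
     sides. *)
  have P_neq0 : \det (map_mx polyC P) != 0.
    by rewrite det_map_mx /= polyC_eq0 -unitfE.
  apply: (mulfI P_neq0); rewrite [RHS]mulrC -!det_mulmx; congr (\det _).
  rewrite /char_poly_mx mulmxBr mulmxBl -!map_mxM PM.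
  by rewrite mul_scalar_mx mul_mx_scalar.
rewrite char_poly_trig ?diag_mx_is_trig //.
by apply: eq_bigr => i _; rewrite mxE eqxx mulr1n.
Qed.

(** Courant-Fischer argument: the eigenvectors of two eigenvalues below [kappa] would span a plane
    containing a nonzero vector orthogonal to [c], which violates the form bound. *)
Lemma second_eigenvalue_ge (R : rcfType) n (mu c : 'rV[R]_n) (M : 'M[R]_n)
    (kappa : R) :
  (forall i, 0 < mu 0 i) -> (diag_mx mu *m M)^T = diag_mx mu *m M ->
  (forall v : 'rV_n, v *m diag_mx mu *m c^T = 0 ->
     kappa * (v *m diag_mx mu *m v^T) 0 0 <=
     (v *m diag_mx mu *m M *m v^T) 0 0) ->
  (1 < n)%N ->
  exists2 s : seq R,
    sorted <=%R s /\ char_poly M = \prod_(a <- s) ('X - a%:P) &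
    kappa <= s`_1.
Proof.
move=> mu_gt0 symM form_ge n_gt1.
have [P [d PP PM]] := weighted_spectral _ _ _ _ mu_gt0 symM.
exists (sort <=%R [seq d 0 i | i <- enum 'I_n]).
  split; first exact/sort_sorted/le_total.
  rewrite (perm_big _ (permEl (perm_sort _ _))) big_map big_enum /=.
  by apply: char_poly_eigenbasis PM; rewrite -mulmxA in PP;
    case/mulmx1_unit: PP.
(* In a sorted list of length above 1, entry 1 is at least [kappa] once at most one entry lies below
   [kappa]. *)
apply: nth_count_ge; first exact/sort_sorted/le_total.
rewrite size_sort size_map size_enum_ord n_gt1 andbT count_sort count_map.
have -> : count (preim (d 0) (< kappa)) (enum 'I_n) =
    #|[pred k | d 0 k < kappa]|.
  by rewrite cardE -size_filter enumT.
rewrite leqNgt; apply/negP => /card_gt1P[i [j []]].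
rewrite !inE /= => di dj ij.
(* [g] holds the products of the eigenvectors with [c]. The coefficients [g j 0] and [- g i 0] give
   a combination orthogonal to [c]; if both vanish, eigenvector [i] alone is taken. *)
pose g := P *m diag_mx mu *m c^T.
pose a := if (g i 0 == 0) && (g j 0 == 0) then 1 else g j 0.
pose b := if (g i 0 == 0) && (g j 0 == 0) then 0 else - g i 0.
have ab_neq0 : (a != 0) || (b != 0).
  rewrite /a /b; case: ifPn => [_|]; first by rewrite oner_eq0.
  by rewrite negb_and oppr_eq0 orbC.
pose x : 'rV[R]_n := \row_k (a * (k == i)%:R + b * (k == j)%:R).
have xi : x 0 i = a by rewrite mxE eqxx (negPf ij) mulr1 mulr0 addr0.
have xj : x 0 j = b by rewrite mxE eqxx eq_sym (negPf ij) mulr1 mulr0 add0r.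
have xk k : k != i -> k != j -> x 0 k = 0.
  by move=> /negPf ki /negPf kj; rewrite mxE ki kj !mulr0 addr0.
have sum_x (F : 'I_n -> R) : (forall k, x 0 k = 0 -> F k = 0) ->
    \sum_k F k = F i + F j.
  move=> F0; rewrite (bigD1 i) //= (bigD1 j) 1?eq_sym //= big1 ?addr0 //.
  by move=> k /andP[ki kj]; apply/F0/xk.
have xg : x *m P *m diag_mx mu *m c^T = 0.
  rewrite -!mulmxA [P *m _]mulmxA -/g; apply/matrixP => r s.
  rewrite !ord1 [LHS]mxE sum_x ?xi ?xj => [|k ->]; last by rewrite mul0r.
  rewrite /a /b [RHS]mxE; case: ifP => [/andP[/eqP-> /eqP->]|_]; ring.
have := form_ge _ xg; rewrite -subr_ge0 (form_eigenbasis _ _ _ _ _ _ PP PM).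
rewrite sum_x ?xi ?xj => [|k ->]; last by rewrite expr0n mulr0.
apply/negP; rewrite -ltNge.
rewrite -(subr_lt0 kappa) in di; rewrite -(subr_lt0 kappa) in dj.
have [ha hb] : (d 0 i - kappa) * a ^+ 2 <= 0 /\ (d 0 j - kappa) * b ^+ 2 <= 0.
  by rewrite !mulr_le0_ge0 ?sqr_ge0 // ltW.
case/orP: ab_neq0 => nz; [apply: ltr_nwDl => // | apply: ltr_nwDr => //].
  by rewrite nmulr_rlt0 // lt0r sqr_ge0 sqrf_eq0 nz.
by rewrite nmulr_rlt0 // lt0r sqr_ge0 sqrf_eq0 nz.
Qed.

(** In an eigenbasis, a vector proportional to [c] contributes nothing, as [v] is orthogonal to [c],
    and every other one has eigenvalue at least [kappa]. *)
Lemma form_ge_of_eigenvectors (R : rcfType) n (mu c : 'rV[R]_n) (M : 'M[R]_n)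
    (kappa : R) :
  (forall i, 0 < mu 0 i) -> (diag_mx mu *m M)^T = diag_mx mu *m M ->
  (forall a (p : 'rV_n), p *m M^T = a *: p ->
     kappa <= a \/ exists b, p = b *: c) ->
  forall v : 'rV_n, v *m diag_mx mu *m c^T = 0 ->
  kappa * (v *m diag_mx mu *m v^T) 0 0 <= (v *m diag_mx mu *m M *m v^T) 0 0.
Proof.
move=> mu_gt0 symM eig v vc.
have [P [d PP PM]] := weighted_spectral _ _ _ _ mu_gt0 symM.
(* Orthonormality makes [diag_mx mu *m P^T] the inverse of [P], so [x] is the coordinate vector of
   [v]. *)
pose x := v *m (diag_mx mu *m P^T).
have -> : v = x *m P.
  by rewrite -mulmxA mulmx1C ?mulmx1 // mulmxA.
rewrite -subr_ge0 (form_eigenbasis _ _ _ _ _ _ PP PM).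
apply: sumr_ge0 => k _.
have [|kd|[b Pk]] := eig (d 0 k) (row k P).
- by rewrite -row_mul PM row_mul row_diag_mx -scalemxAl -rowE.
- by rewrite mulr_ge0 ?sqr_ge0 ?subr_ge0.
suff -> : x 0 k = 0 by rewrite expr0n mulr0.
have -> : x 0 k = (v *m diag_mx mu *m (row k P)^T) 0 0.
  by rewrite /x mulmxA !mxE; apply: eq_bigr => i _; rewrite !mxE.
by rewrite Pk linearZ /= -scalemxAr vc scaler0 mxE.
Qed.

(** * Self-adjoint kernels and linear systems on a finite type *)

Section FunctionForms.
Variables (R : rcfType) (T : finType) (mu : T -> R) (K : T -> T -> R).
Hypothesis mu_gt0 : forall x, 0 < mu x.
Hypothesis K_sym : forall x y, mu x * K x y = mu y * K y x.

Let w : 'rV[R]_#|T| := \row_i mu (enum_val i).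
Let M : 'M[R]_#|T| := \matrix_(i, j) K (enum_val i) (enum_val j).
Let vec (f : T -> R) : 'rV[R]_#|T| := \row_i f (enum_val i).

Lemma sum_enum_val (F : T -> R) : \sum_(i < #|T|) F (enum_val i) = \sum_x F x.
Proof. by rewrite -big_enum_val. Qed.

Let w_gt0 i : 0 < w 0 i. Proof. by rewrite mxE. Qed.

Let M_sym : (diag_mx w *m M)^T = diag_mx w *m M.
Proof. by apply/matrixP => i j; rewrite mxE !mul_diag_mx !mxE K_sym. Qed.

Let vecK (v : 'rV[R]_#|T|) : v = vec (fun x => v 0 (enum_rank x)).
Proof. by apply/rowP => i; rewrite mxE enum_valK. Qed.

Let dotE f g : (vec f *m diag_mx w *m (vec g)^T) 0 0 = \sum_x mu x * f x * g x.
Proof.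
rewrite -sum_enum_val mxE; apply: eq_bigr => i _.
by rewrite mul_mx_diag !mxE mulrC [f _ * _]mulrC mulrC.
Qed.

Let formE f : (vec f *m diag_mx w *m M *m (vec f)^T) 0 0 =
  \sum_x mu x * f x * (\sum_y K x y * f y).
Proof.
rewrite -mulmxA -sum_enum_val mxE; apply: eq_bigr => i _.
rewrite mul_mx_diag !mxE -sum_enum_val [f _ * _]mulrC; congr (_ * _).
by apply: eq_bigr => j _; rewrite !mxE.
Qed.

(** With the constant function 1 as [c], orthogonality means zero mean. The matrix has the shape of
    [dtn_mx]. *)
Lemma second_eigenvalue_kernel_ge (kappa : R) :
  (forall f, \sum_x mu x * f x = 0 ->
     kappa * (\sum_x mu x * f x ^+ 2) <=
     \sum_x mu x * f x * (\sum_y K x y * f y)) ->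
  (1 < #|T|)%N ->
  exists2 s : seq R,
    sorted <=%R s /\
    char_poly (\matrix_(i < #|T|, j < #|T|) K (enum_val i) (enum_val j)) =
      \prod_(a <- s) ('X - a%:P) &
    kappa <= s`_1.
Proof.
move=> form_ge; apply: (@second_eigenvalue_ge R _ w (vec (fun=> 1)) M) => // v.
rewrite (vecK v); set f := fun x => _.
move=> /matrixP/(_ 0 0); rewrite dotE mxE formE dotE => f_mean.
have -> : \sum_x mu x * f x * f x = \sum_x mu x * f x ^+ 2.
  by apply: eq_bigr => x _; rewrite -mulrA.
by apply: form_ge; rewrite -[RHS]f_mean; apply: eq_bigr => x _; rewrite mulr1.
Qed.

(** Here too [c] is the constant function 1, so the eigenfunctions exempt from the bound are the
    constants. *)
Lemma poincare_of_eigenfunctions (kappa : R) :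
  (forall a f, (forall x, \sum_y K x y * f y = a * f x) ->
     kappa <= a \/ forall x y, f x = f y) ->
  forall f, \sum_x mu x * f x = 0 ->
  kappa * (\sum_x mu x * f x ^+ 2) <=
  \sum_x mu x * f x * (\sum_y K x y * f y).
Proof.
move=> eig f f_mean.
have -> : \sum_x mu x * f x ^+ 2 = \sum_x mu x * f x * f x.
  by apply: eq_bigr => x _; rewrite -mulrA.
rewrite -dotE -formE.
apply: (@form_ge_of_eigenvectors R _ w (vec (fun=> 1)) M) => //; last first.
  apply/matrixP => i j; rewrite !ord1 dotE mxE -[RHS]f_mean.
  by apply: eq_bigr => x _; rewrite mulr1.
move=> a p pM.
have [|ka|pconst] := eig a (fun x => p 0 (enum_rank x)); last 2 first.
- by left.
- right; have [i _|n0] := pickP 'I_#|T|.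
    exists (p 0 i); apply/rowP => j; rewrite !mxE mulr1.
    by have := pconst (enum_val j) (enum_val i); rewrite !enum_valK.
  by exists 0; apply/rowP => j; have := n0 j.
- move=> x; move/rowP/(_ (enum_rank x)): pM; rewrite !mxE => <-.
  rewrite -sum_enum_val; apply: eq_bigr => i _.
  by rewrite !mxE enum_rankK enum_valK mulrC.
Qed.

End FunctionForms.

(** Serves to deduce the existence of harmonic extensions from their uniqueness. *)
Lemma solvable_of_injective (F : fieldType) (T : finType) (K : T -> T -> F) :
  (forall u, (forall x, \sum_y K x y * u y = 0) -> forall x, u x = 0) ->
  forall g, exists u, forall x, \sum_y K x y * u y = g x.
Proof.
move=> inj g.
pose N : 'M[F]_#|T| := \matrix_(i, j) K (enum_val j) (enum_val i).
have mulE (v : 'rV_#|T|) x : (v *m N) 0 (enum_rank x) =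
    \sum_y K x y * v 0 (enum_rank y).
  rewrite mxE (reindex_onto enum_rank enum_val) /=; last first.
    by move=> *; exact: enum_valK.
  apply: eq_big => [y|y _]; first by rewrite enum_rankK eqxx.
  by rewrite mxE !enum_rankK mulrC.
have Nunit : N \in unitmx.
  rewrite -row_free_unit; apply: inj_row_free => v vN.
  apply/rowP => i; rewrite mxE -(enum_valK i).
  by apply: (inj (fun y => v 0 (enum_rank y))) => x; rewrite -mulE vN mxE.
exists (fun x => ((\row_i g (enum_val i)) *m invmx N) 0 (enum_rank x)) => x.
by rewrite -mulE mulmxKV // mxE enum_rankK.
Qed.

(** * Laplacian, Green's formula and Dirichlet energy *)

Section Graph.
Variables (R : realType) (V : finType) (G : weighted_graph R V).
Implicit Types (x y z : V) (u v : V -> R).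
Local Notation m := (vmeas G).
Local Notation w := (weight G).
Local Notation Lap := (laplacian G).

Lemma laplacian_sum (I : finType) (c : I -> R) (u : I -> V -> R) x :
  Lap (fun z => \sum_i c i * u i z) x = \sum_i c i * Lap (u i) x.
Proof.
rewrite /laplacian; under eq_bigr => y _ do rewrite -sumrB mulr_suml.
rewrite exchange_big mulr_sumr; apply: eq_bigr => i _ /=.
by rewrite !mulr_sumr; apply: eq_bigr => y _; ring.
Qed.

Lemma eq_laplacian u v x : u =1 v -> Lap u x = Lap v x.
Proof. by move=> /funext ->. Qed.

Lemma laplacian_delta u x :
  Lap u x = \sum_y Lap (fun z => (z == y)%:R) x * u y.
Proof.
under eq_bigr => y _ do rewrite mulrC.
rewrite -laplacian_sum; apply: eq_laplacian => z.
by rewrite (bigD1 z) //= eqxx mulr1 big1 ?addr0 // => y /negPf yz;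
  rewrite eq_sym yz mulr0.
Qed.

Lemma laplacian_scale u c x : Lap (fun z => c * u z) x = c * Lap u x.
Proof.
rewrite /laplacian !mulr_sumr; apply: eq_bigr => y _; ring.
Qed.

(** Exchange [x] and [y] and average, using the symmetry of the weights; the division by 2
    compensates for counting each edge in both directions. *)
Lemma green u v :
  \sum_x m x * u x * Lap v x =
  - (\sum_x \sum_y (u x - u y) * (v x - v y) * w x y) / 2.
Proof.
have -> : \sum_x m x * u x * Lap v x =
    \sum_x \sum_y u x * (v y - v x) * w x y.
  apply: eq_bigr => x _; rewrite /laplacian [m x * _]mulrC -mulrA mulVKf.
    by rewrite mulr_sumr; apply: eq_bigr => y _; rewrite mulrA.
  by rewrite gt_eqF ?vmeas_gt0.
set S := \sum_x _; set E := \sum_x _.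
suff SE : S + S = - E by rewrite -SE; lra.
rewrite {2}/S exchange_big -big_split -sumrN; apply: eq_bigr => x _ /=.
rewrite -big_split -sumrN; apply: eq_bigr => y _ /=.
by rewrite (weight_sym G y x); ring.
Qed.

Lemma laplacian_sym u v :
  \sum_x m x * u x * Lap v x = \sum_x m x * v x * Lap u x.
Proof.
rewrite !green; congr (- _ / 2); apply: eq_bigr => x _; apply: eq_bigr => y _.
ring.
Qed.

(** The energy is a sum of nonnegative terms, so its vanishing forces equality across each edge, and
    connectedness spreads it along paths. *)
Lemma energy0_const u : \sum_x m x * u x * Lap u x = 0 -> forall x y, u x = u y.
Proof.
rewrite green => /eqP; rewrite mulf_eq0 oppr_eq0 invr_eq0 pnatr_eq0 orbF.
have ge0 x y : 0 <= (u x - u y) * (u x - u y) * w x y.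
  rewrite mulr_ge0 -?expr2 ?sqr_ge0 //.
  have [/(weight_gt0 (w := G))/ltW//|/weight_eq0->//] := boolP (adj G x y).
rewrite psumr_eq0 => [/allP E0 x y|x _]; last by rewrite sumr_ge0.
have edge a b : adj G a b -> u a = u b.
  move=> ab; have := E0 a (mem_index_enum a); rewrite psumr_eq0 //.
  move=> /allP/(_ b (mem_index_enum b)).
  rewrite !mulf_eq0 orbb (gt_eqF (weight_gt0 ab)) orbF subr_eq0.
  by move=> /eqP.
have /connectP[p] := adj_connected G x y.
by elim: p x => [x _ ->|z p IHp x /= /andP[/edge-> /IHp]].
Qed.

(** * Graph distance and the curvature bound on eigenvalues *)

Lemma gdist_gt0 x y : x != y -> 0 < (gdist G x y)%:R :> R.
Proof.
move=> xy; rewrite ltr0n lt0n /gdist; case: ex_minnP => -[|n] //.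
by case/existsP => p; rewrite tuple0 /= (negPf xy).
Qed.

Lemma gdist_sym x y : gdist G x y = gdist G y x.
Proof.
have walk_sym a b n : walk_of_length G a b n -> walk_of_length G b a n.
  case/existsP => p /andP[ap /eqP <-]; apply/existsP.
  have sz : size (rev (belast a p)) == n.
    by rewrite size_rev size_belast size_tuple.
  exists (Tuple sz) => /=; rewrite rev_path.
  rewrite (eq_path (e' := adj G)) => [|? ?]; last by rewrite adj_sym.
  by rewrite ap; case: (tval p) => //= c q; rewrite rev_cons last_rcons.
rewrite /gdist; case: ex_minnP => i /walk_sym wi mini.
case: ex_minnP => j /walk_sym wj minj.
by apply/eqP; rewrite eqn_leq mini ?minj.
Qed.

(* If the Lipschitz constant L > 0 of v is attained at (x, y), then v / L or
   - v / L competes in the infimum defining the curvature at (x, y). *)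
Lemma eigenfunction_curvature (kappa a : R) v :
  0 < kappa ->
  (forall x y, x != y -> kappa <= ollivier_curvature G x y) ->
  (forall x, - Lap v x = a * v x) ->
  kappa <= a \/ forall x y, v x = v y.
Proof.
move=> kappa_gt0 curv eig.
have [/existsP[x0 /existsP[y0 xy0]]|nconst] :=
  boolP [exists x, [exists y, v x != v y]]; last first.
  right=> x y; apply/eqP; apply: contraNT nconst => xy.
  by apply/existsP; exists x; apply/existsP; exists y.
left.
(* There are finitely many pairs, so the Lipschitz constant is attained as a maximum of slopes. *)
pose slope (p : V * V) : R := `|v p.1 - v p.2| / (gdist G p.1 p.2)%:R.
have neq0 : (x0, y0).1 != (x0, y0).2 by apply: contraNneq xy0 => /= ->.
case: (@arg_maxP _ R _ (x0, y0) (fun p => p.1 != p.2) slope neq0).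
move=> [x y] /= xy max_xy; set L := slope (x, y) in max_xy.
have L_gt0 : 0 < L.
  apply: lt_le_trans (max_xy _ neq0).
  by rewrite divr_gt0 ?gdist_gt0 // normr_gt0 subr_eq0.
have d_gt0 := gdist_gt0 _ _ xy.
(* The sign makes [f y - f x] positive, as the constraint [grad f y x = 1] demands. *)
pose s : R := Num.sg (v y - v x).
pose f z := s / L * v z.
have vyx : v y - v x != 0.
  move: L_gt0; rewrite /L /slope /= pmulr_lgt0 ?invr_gt0 // normr_gt0.
  by rewrite -oppr_eq0 opprB.
have fyx : f y - f x = (gdist G x y)%:R.
  rewrite /f -mulrBr mulrAC -normrEsg distrC /L /slope /=.
  by rewrite invf_div mulrCA divff ?mulr1 // normr_eq0 -oppr_eq0 opprB.
have f_lip : lip1 G f.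
  move=> z t /=; have [->|zt] := eqVneq z t; first by rewrite subrr normr0.
  rewrite /f -mulrBr normrM normrM normrV ?unitfE ?gt_eqF // (gtr0_norm L_gt0).
  rewrite normr_sg vyx mul1r ler_pdivrMl // -ler_pdivrMr ?gdist_gt0 //.
  exact: (max_xy (z, t)).
have Lapf z : Lap f z = - (a * f z).
  by rewrite laplacian_scale -[Lap v z]opprK eig /f; ring.
(* [f] is again an eigenfunction, so the quantity minimised by the curvature takes the value [a] at
   [f]. *)
have fa : a = grad G (Lap f) x y.
  rewrite /grad !Lapf -fyx opprK addrC -mulrBr mulfK //.
  by rewrite fyx gt_eqF.
rewrite fa; pose E := [set grad G (Lap g) x y | g in
  [set g | lip1 G g /\ grad G g y x = 1]]%classic.
have Ea : E (grad G (Lap f) x y).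
  exists f => //; split=> //.
  by rewrite /grad fyx gdist_sym divff ?gt_eqF // gdist_sym.
apply: le_trans (curv _ _ xy) _; rewrite /ollivier_curvature -/E.
(* Were [E] unbounded below, [inf E] would be its default 0, against [0 < kappa]. *)
apply: ge_inf => //; apply: contrapT => noinf.
have := curv _ _ xy; rewrite /ollivier_curvature -/E inf_out.
  by rewrite leNgt kappa_gt0.
by case.
Qed.


(** * Harmonic extension and Dirichlet-to-Neumann map *)

Variable B : {set V}.
Hypothesis B_neq0 : exists x, x \in B.
Implicit Types (f g : bvertex B -> R).
Local Notation ext := (harmonic_extension G).
Local Notation delta b := (fun c : bvertex B => (c == b)%:R).

(** At every vertex either [u] or its Laplacian vanishes, so the energy is zero and [u] is constant,
    with a zero on [B]. *)
Lemma dirichlet_unique u :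
  (forall x, x \in B -> u x = 0) -> (forall x, x \notin B -> Lap u x = 0) ->
  forall x, u x = 0.
Proof.
move=> uB uI x; have [b bB] := B_neq0; rewrite -(uB b bB).
apply: energy0_const; rewrite big1 // => z _.
by have [/uB->|/uI->] := boolP (z \in B); rewrite mulr0 ?mul0r.
Qed.

Lemma harmonic_extension_exists f : exists u, is_harmonic_extension G f u.
Proof.
(* The Dirichlet problem as a square system: identity rows on [B], Laplacian rows on the interior.
   The right-hand side below is [f] extended by 0. *)
pose K x y := if x \in B then (x == y)%:R else Lap (fun z => (z == y)%:R) x.
have KE u x : \sum_y K x y * u y = if x \in B then u x else Lap u x.
  rewrite /K; case: ifP => _; last by rewrite [RHS]laplacian_delta.
  rewrite (bigD1 x) //= eqxx mul1r big1 ?addr0 // => y /negPf yx.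
  by rewrite eq_sym yx mul0r.
have [|u uE] := solvable_of_injective R V K _
  (fun x => oapp f 0 (insub x : option (bvertex B))).
  move=> u u0; apply: dirichlet_unique => x xB; have := u0 x; rewrite KE.
    by rewrite xB.
  by rewrite (negPf xB).
exists u; split=> [x|x xB]; [have := uE (val x) | have := uE x]; rewrite KE.
  by rewrite (valP x) valK.
by rewrite (negPf xB) insubN.
Qed.

Lemma ext_harmonic f : is_harmonic_extension G f (ext f).
Proof. by apply: xgetPex; apply: harmonic_extension_exists. Qed.

Lemma ext_boundary f (x : bvertex B) : ext f (val x) = f x.
Proof. by case: (ext_harmonic f). Qed.

Lemma ext_interior f x : x \notin B -> Lap (ext f) x = 0.
Proof. by case: (ext_harmonic f) => _; apply. Qed.

(** Linearity of the extension comes from uniqueness: the difference of the two sides vanishes on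
    [B] and is harmonic elsewhere. *)
Lemma ext_sum f x :
  ext f x = \sum_(b : bvertex B) f b * ext (delta b) x.
Proof.
pose v z := \sum_(b : bvertex B) f b * ext (delta b) z.
apply/eqP; rewrite -/(v x) -subr_eq0; apply/eqP; move: x.
have LapB z : Lap (fun t => ext f t - v t) z = Lap (ext f) z - Lap v z.
  rewrite /laplacian -mulrBr -sumrB; congr (_ * _).
  by apply: eq_bigr => y _; ring.
apply: dirichlet_unique => z zB.
  pose b0 : bvertex B := exist _ z zB.
  have extz g : ext g z = g b0 := ext_boundary g b0.
  rewrite extz /v (bigD1 b0) //= extz eqxx mulr1 big1 ?addr0 ?subrr // => b.
  by rewrite extz eq_sym => /negPf->; rewrite mulr0.
rewrite LapB laplacian_sum ext_interior // big1 ?subr0 // => b _.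
by rewrite ext_interior // mulr0.
Qed.

Lemma dtn_laplacian f (x : bvertex B) : dtn G f x = - Lap (ext f) (val x).
Proof.
rewrite /dtn /normal_derivative /laplacian -mulrN -sumrN; congr (_ * _).
by apply: eq_bigr => y _; ring.
Qed.

(** The entries of [dtn_mx], indexed by boundary vertices instead of ordinals. *)
Definition dtn_kernel (x y : bvertex B) : R := dtn G (delta y) x.

Lemma dtn_kernel_sum f (x : bvertex B) :
  \sum_y dtn_kernel x y * f y = dtn G f x.
Proof.
rewrite dtn_laplacian (eq_laplacian _ _ _ (ext_sum f)) laplacian_sum -sumrN.
by apply: eq_bigr => y _; rewrite /dtn_kernel dtn_laplacian mulNr mulrC.
Qed.

(** Interior terms vanish because [ext g] is harmonic there. By [green] the right-hand side is the
    Dirichlet energy pairing of the extensions. *)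
Lemma dtn_form f g :
  \sum_(x : bvertex B) m (val x) * f x * dtn G g x =
  - \sum_x m x * ext f x * Lap (ext g) x.
Proof.
rewrite [in RHS](bigID (mem B)) /= addrC.
rewrite [X in - (X + _)]big1 ?add0r; last first.
  by move=> x xB; rewrite ext_interior // mulr0.
rewrite (big_sub (mem B)) -sumrN; apply: eq_bigr => x _.
by rewrite dtn_laplacian -ext_boundary mulrN.
Qed.

(** Each side is the form of [dtn_form] at two indicator functions, symmetric by [laplacian_sym]. *)
Lemma dtn_kernel_sym (x y : bvertex B) :
  m (val x) * dtn_kernel x y = m (val y) * dtn_kernel y x.
Proof.
have E (a b : bvertex B) : m (val a) * dtn_kernel a b =
    \sum_(c : bvertex B) m (val c) * delta a c * dtn G (delta b) c.
  rewrite (bigD1 a) //= eqxx mulr1 big1 ?addr0 // => c /negPf->.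
  by rewrite mulr0 mul0r.
by rewrite !E !dtn_form laplacian_sym.
Qed.

Lemma dtn_form_ge (kappa : R) f :
  0 < kappa ->
  (forall v, \sum_x m x * v x = 0 ->
     kappa * (\sum_x m x * v x ^+ 2) <= - \sum_x m x * v x * Lap v x) ->
  \sum_(x : bvertex B) m (val x) * f x = 0 ->
  kappa * (\sum_(x : bvertex B) m (val x) * f x ^+ 2) <=
  \sum_(x : bvertex B) m (val x) * f x * dtn G f x.
Proof.
move=> kappa_gt0 poincare f_mean; rewrite dtn_form.
(* Shifting the extension by its mean c over V only increases the norm on B,
   where f has mean 0. *)
pose c := (\sum_x m x * ext f x) / (\sum_x m x).
have m_sum : 0 < \sum_x m x.
  have [b _] := B_neq0; rewrite (bigD1 b) //= ltr_pwDl ?vmeas_gt0 //.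
  by apply: sumr_ge0 => x _; rewrite ltW ?vmeas_gt0.
have := poincare (fun x => ext f x - c).
have -> : \sum_x m x * (ext f x - c) = 0.
  under eq_bigr => x _ do rewrite mulrBr.
  by rewrite sumrB -mulr_suml mulrCA divff ?mulr1 ?subrr // gt_eqF.
(* By [green] only differences of values enter, so the shift by [c] cancels. *)
have -> : \sum_x m x * (ext f x - c) * Lap (fun z => ext f z - c) x =
    \sum_x m x * ext f x * Lap (ext f) x.
  rewrite !green; congr (- _ / 2).
  by apply: eq_bigr => x _; apply: eq_bigr => y _; ring.
move=> /(_ erefl); apply: le_trans; rewrite ler_pM2l //.
(* The interior part of the norm over [V] is nonnegative and is dropped. *)
rewrite [leRHS](bigID (mem B)) /= (big_sub (mem B)).
rewrite -[leLHS]addr0 lerD //; last first.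
  by apply: sumr_ge0 => x _; rewrite mulr_ge0 ?sqr_ge0 // ltW ?vmeas_gt0.
have -> : \sum_(x : bvertex B) m (val x) * (ext f (val x) - c) ^+ 2 =
    \sum_(x : bvertex B) m (val x) * f x ^+ 2
    + \sum_(x : bvertex B) m (val x) * c ^+ 2
    - (\sum_(x : bvertex B) m (val x) * f x) * (2 * c).
  rewrite mulr_suml -big_split -sumrB; apply: eq_bigr => x _ /=.
  by rewrite ext_boundary; ring.
rewrite f_mean mul0r subr0 lerDl.
by apply: sumr_ge0 => x _; rewrite mulr_ge0 ?sqr_ge0 // ltW ?vmeas_gt0.
Qed.

End Graph.

(** * From the curvature bound to the second Steklov eigenvalue *)

Theorem corollary1p5 (R : realType) (V : finType) (G : weighted_graph R V)
    (B : {set V}) (kappa : R) :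
  is_boundary G B ->
  (2 <= #|B|)%N ->
  0 < kappa ->
  (forall x y : V, x != y -> kappa <= ollivier_curvature G x y) ->
  kappa <= steklov_eigenvalue G B 2.
Proof.
move=> [B_neq0 _ _] cardB kappa_gt0 curv.
(* The kernel of minus the Laplacian, self-adjoint for [vmeas G], to which
   [poincare_of_eigenfunctions] applies. *)
pose K x y := - laplacian G (fun z => (z == y)%:R) x.
have KE u x : \sum_y K x y * u y = - laplacian G u x.
  rewrite [laplacian G u x]laplacian_delta -sumrN.
  by apply: eq_bigr => y _; rewrite mulNr.
have K_sym x y : vmeas G x * K x y = vmeas G y * K y x.
  pose d (b z : V) : R := (z == b)%:R.
  have E a b : vmeas G a * K a b =
      - \sum_z vmeas G z * d a z * laplacian G (d b) z.
    rewrite (bigD1 a) //= /d eqxx mulr1 big1 ?addr0 ?mulrN // => z /negPf->.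
    by rewrite mulr0 mul0r.
  by rewrite !E laplacian_sym.
have poincare u : \sum_x vmeas G x * u x = 0 ->
    kappa * (\sum_x vmeas G x * u x ^+ 2) <=
    - \sum_x vmeas G x * u x * laplacian G u x.
  have -> : - \sum_x vmeas G x * u x * laplacian G u x =
      \sum_x vmeas G x * u x * (\sum_y K x y * u y).
    by rewrite -sumrN; apply: eq_bigr => x _; rewrite KE mulrN.
  apply: poincare_of_eigenfunctions; [exact: vmeas_gt0 | exact: K_sym |].
  move=> a v eig; apply: (eigenfunction_curvature R V G) => // x.
  by rewrite -KE.
have [||s [s_sorted s_char] kappa_le] := @second_eigenvalue_kernel_ge R
  (bvertex B) (fun x => vmeas G (val x)) (dtn_kernel R V G B)
  (fun x => vmeas_gt0 G (val x)) (dtn_kernel_sym R V G B B_neq0) kappa.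
- move=> f f_mean; under [leRHS]eq_bigr => x _ do rewrite dtn_kernel_sum //.
  exact: dtn_form_ge.
- by rewrite card_sig.
(* The list [s] witnesses that the specification is satisfiable, so [xget] does not return its
   default, the empty list. *)
have [t_sorted t_char] : [set t : seq R | sorted <=%R t /\
    char_poly (dtn_mx G B) = \prod_(a <- t) ('X - a%:P)]%classic
    (steklov_spectrum G B).
  by apply: xgetPex; exists s.
rewrite /steklov_eigenvalue /=.
(* Equal products of linear factors have the same roots with multiplicity, so the two sorted lists
   coincide. Entry 1 is the second eigenvalue, as [steklov_eigenvalue] counts from 1. *)
suff -> : steklov_spectrum G B = s by [].
apply: le_sorted_eq => //; apply: prod_XsubC_eq.
by rewrite -t_char -s_char.
Qed.
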